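(* Let $V$ be a vector space over a field, let $W$ be a subspace of $V$, let $\mathbb{S}(W)$ be a subsemigroup of $L(W)$, and let $f\in L_{\mathbb{S}(W)}(V)$. Then $f$ is a regular element of $L_{\mathbb{S}(W)}(V)$ if and only if both of the following hold: (i) $f_{\upharpoonright_W}$ is a regular element of $\mathbb{S}(W)$; (ii) $R(f)\cap W=R(f_{\upharpoonright_W})$.
   Context: For a vector space $U$, $L(U)$ is the semigroup of all linear maps $U\to U$ under composition (composed from left to right, with $vf$ denoting the image of $v$ under $f$). For $f\in L(V)$ with $Wf\subseteq W$, $f_{\upharpoonright_W}\in L(W)$ denotes the linear map $W\to W$ that agrees with $f$ on $W$. Define $L_{\mathbb{S}(W)}(V)=\{f\in L(V) : Wf\subseteq W \text{ and } f_{\upharpoonright_W}\in\mathbb{S}(W)\}$, a subsemigroup of $L(V)$. $R(h)$ denotes the image of a map $h$. An element $a$ of a semigroup $S$ is regular in $S$ if there is $b\in S$ with $aba=a$. *)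

(* Defs.v *)
From HB Require Import structures.
From mathcomp Require Import all_boot all_order all_algebra.
From mathcomp Require Import boolp classical_sets.

Set Implicit Arguments.
Unset Strict Implicit.
Unset Printing Implicit Defensive.

Import GRing.Theory.
Local Open Scope ring_scope.
Local Open Scope classical_set_scope.

Section LinearEndomorphisms.
Variables (K : fieldType) (U : lmodType K).

Definition lin_end : Type := {linear U -> U}.

Definition lin_end_fun (f : lin_end) : {linear U -> U} := f.
Coercion lin_end_fun : lin_end >-> GRing.Linear.type.

HB.instance Definition _ := gen_eqMixin lin_end.
HB.instance Definition _ := gen_choiceMixin lin_end.

Lemma lin_endP (f g : lin_end) : (f : U -> U) =1 g -> f = g.
Proof.
case: f g => [f cf] [g cg] /= fg; have {}fg : f = g by exact: funext.
case: _ / fg cg => cg; congr GRing.Linear.Pack.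
case: cf cg => [[a1] [a2]] [[b1] [b2]].
by rewrite (Prop_irrelevance a1 b1) (Prop_irrelevance a2 b2).
Qed.

(* Maps act on the right: [f * g] is "first [f], then [g]". *)
Definition lin_end_mul (f g : lin_end) : lin_end :=
  (lin_end_fun g \o lin_end_fun f : {linear U -> U}).

Lemma lin_end_mulA : associative lin_end_mul.
Proof. by move=> f g h; apply: lin_endP. Qed.

HB.instance Definition _ := isSemigroup.Build lin_end lin_end_mulA.

End LinearEndomorphisms.

Definition regular_in (G : semigroupType) (S : mulgClosed G) (a : G) : Prop :=
  a \in S /\ exists2 b, b \in S & (a * b * a)%g = a.

Section Subspace.
Variables (K : fieldType) (V : lmodType K) (W : submodClosed V).

(* The subspace [W] as a vector space in its own right. *)
Record subspace : Type :=
  Subspace { subspace_val : V; subspace_valP : subspace_val \in W }.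

HB.instance Definition _ := [isSub for subspace_val].
HB.instance Definition _ := [Choice of subspace by <:].
HB.instance Definition _ := [SubChoice_isSubLmodule of subspace by <:].

Definition stable (f : lin_end V) : Prop := {in W, forall w, f w \in W}.

Section Restriction.
Variables (f : lin_end V) (fW : stable f).

Definition restr_fun (w : subspace) : subspace :=
  Subspace (fW (subspace_valP w)).

Lemma restr_is_linear : linear restr_fun.
Proof. by move=> a u v; apply: val_inj; rewrite /= linearP. Qed.

HB.instance Definition _ :=
  GRing.isLinear.Build K subspace subspace _ restr_fun restr_is_linear.

Definition restr : lin_end subspace := (restr_fun : {linear subspace -> subspace}).

End Restriction.

Variable SW : mulgClosed (lin_end subspace).

Definition LSW : {pred lin_end V} :=
  [pred f | `[< exists fW : stable f, restr fW \in SW >]].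

Lemma LSW_stable (f : lin_end V) : f \in LSW -> stable f.
Proof. by move=> /asboolP[]. Qed.

Lemma LSW_mulg_closed : mulg_closed LSW.
Proof.
move=> f g /asboolP[fW fS] /asboolP[gW gS]; apply/asboolP.
have fgW : stable (f * g)%g by move=> w wW; exact: (gW _ (fW _ wW)).
exists fgW; suff -> : restr fgW = (restr fW * restr gW)%g by exact: gpredM.
by apply: lin_endP => w; apply: val_inj.
Qed.

HB.instance Definition _ := isMulClosed.Build (lin_end V) LSW LSW_mulg_closed.

End Subspace.

(* Main.v *)
(** Maps act on the right. If [f = f g f] and [v f] lies in [W], then
    [v f = (v f g) f] with [v f g] in [W], which gives (ii); (i) follows by
    restricting to [W].

    Conversely, let [h] be a quasi-inverse of the restriction of [f]. By (ii) a
    vector [w] of [W] in the range of [f] is of the form [w' f] with [w'] in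
    [W], so [w h f = w' f h f = w' f = w]: the map [h] is a section of [f]
    wherever that makes sense. By Zorn's lemma [h] extends to a linear map [g]
    on [V] that is a section of [f] on the whole range of [f]. *)
Require Import Defs.
From HB Require Import structures.
From mathcomp Require Import all_boot all_order all_algebra.
From mathcomp Require Import boolp classical_sets.

Set Implicit Arguments.
Unset Strict Implicit.
Unset Printing Implicit Defensive.

Import GRing.Theory.
Local Open Scope ring_scope.
Local Open Scope classical_set_scope.

Section SectionExtension.
Variables (K : fieldType) (U V : lmodType K) (f : {linear V -> U}).

(* Graphs of linear maps [g], defined on a subspace of [U], with [f (g u) = u]
   whenever [u] is in the range of [f]. *)
Record section_graph (A : set (U * V)) : Prop := SectionGraph {
  section_graph_linear : forall a p q, A p -> A q -> A (a *: p + q);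
  section_graph_functional : forall p, A p -> p.1 = 0 -> p.2 = 0;
  section_graph_section : forall p, A p -> range f p.1 -> f p.2 = p.1 }.

Definition adjoin (A : set (U * V)) (q : U * V) : set (U * V) :=
  [set r | exists a, exists2 p, A p & r = a *: q + p].

(** For [a = 0] the conditions are those of [A]. A nonzero [a] can be divided out because [A] is
    closed under scaling, which leaves the hypotheses on [q]. *)
Lemma section_graph_adjoin (A : set (U * V)) (q : U * V) :
    section_graph A -> (forall p, A p -> p.1 <> q.1) ->
    (forall p, A p -> range f (q.1 + p.1) -> f (q.2 + p.2) = q.1 + p.1) ->
    A 0 -> section_graph (adjoin A q).
Proof.
move=> [lA funA secA] qA qf A0.
have ZA a p : A p -> A (a *: p) by move=> Ap; rewrite -[_ *: _]addr0; exact: lA.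
split.
- move=> a _ _ [b [p Ap ->]] [c [r Ar ->]].
  exists (a * b + c), (a *: p + r); first exact: lA.
  by rewrite scalerDr scalerA scalerDl addrACA.
- move=> _ [a [p Ap ->]] /=; have [->|a0] := eqVneq a 0.
    by rewrite !scale0r !add0r; exact: funA.
  move=> /eqP; rewrite addr_eq0 => /eqP aq.
  case: (qA _ (ZA (- a^-1) _ Ap)) => /=.
  by rewrite scaleNr -scalerN -aq scalerA mulVf ?scale1r.
- move=> _ [a [p Ap ->]] /=; have [->|a0] := eqVneq a 0.
    by rewrite !scale0r !add0r; exact: secA.
  move=> [z _ fz].
  have /= := qf _ (ZA a^-1 _ Ap).
  have scale (X : lmodType K) (x y : X) : a *: (x + a^-1 *: y) = a *: x + y.
    by rewrite scalerDr scalerA mulfV ?scale1r.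
  rewrite -!scale linearZ => -> //.
  by exists (a^-1 *: z) => //; rewrite linearZ fz -scale /= scalerA mulVf ?scale1r.
Qed.

Lemma maximal_section_graph_total (A : set (U * V)) :
    section_graph A -> A 0 ->
    (forall B, A `<` B -> ~ section_graph B) ->
  forall u, exists v, A (u, v).
Proof.
move=> gA A0 maxA u; apply: contrapT => uA.
have maxq q : (forall p, A p -> p.1 <> q.1) ->
    ~ (forall p, A p -> range f (q.1 + p.1) -> f (q.2 + p.2) = q.1 + p.1).
  move=> qA qf; apply: (maxA (adjoin A q)); last exact: section_graph_adjoin.
  split=> [p Ap|sub]; first by exists 0, p; rewrite // scale0r add0r.
  by apply: (qA q) => //; apply: sub; exists 1, 0; rewrite // scale1r addr0.
have [lA _ secA] := gA.
have subA p r : A p -> A r -> A (r - p).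
  by move=> Ap Ar; rewrite addrC -scaleN1r; exact: lA.
(* The section property constrains the new value only if the coset of [u] modulo the domain of [A]
   meets the range of [f]. If it does, a point of the coset in the range is adjoined, with a
   preimage [z] as value. *)
have [[p Ap [z _ fz]]|nrange] := pselect (exists2 p, A p & range f (u + p.1)).
  apply: (maxq (u + p.1, z)) => [r Ar /= ru|r Ar /= [y _ fy]].
    by apply: uA; exists (r - p).2; rewrite -[u](addrK p.1) -ru; exact: (subA p r).
  (* Both [u + p.1] and its sum with [r.1] are in the range, hence so is [r.1], and the section
     property of [A] applies to [r]. *)
  by rewrite linearD fz secA //; exists (y - z); rewrite // linearB fy fz addrC addKr.
(* Now the section property is vacuous off the domain of [A], so the value 0 serves. *)
apply: (maxq (u, 0)) => [[r1 r2] Ar /= ru|r Ar /= ur].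
  by apply: uA; exists r2; rewrite -ru.
by case: nrange; exists r.
Qed.

Lemma section_extension (W : submodClosed U) (h : {linear subspace W -> V}) :
    (forall w, range f (subspace_val w) -> f (h w) = subspace_val w) ->
  exists2 g : {linear U -> V},
    (forall w, g (subspace_val w) = h w) & (forall v, f (g (f v)) = f v).
Proof.
move=> hf; pose G := range (fun w => (subspace_val w, h w)).
have gG : section_graph G.
  split=> [a _ _ [w _ <-] [w' _ <-]|_ [w _ <-] /= w0|_ [w _ <-] /=].
  - by exists (a *: w + w'); rewrite // linearP.
  - have -> : w = 0 by exact: val_inj.
    exact: linear0.
  - exact: hf.
have G0 : G 0 by exists 0; rewrite // linear0.
(* [set0] is allowed because the empty chain has union [set0]. *)
pose P A := A = set0 \/ G `<=` A /\ section_graph A.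
have [F FP totF|A [PA maxA]] := @Zorn_bigcup _ P.
  have [->|/set0P[p0 [B0 FB0 Bp0]]] := eqVneq (\bigcup_(X in F) X) set0; first by left.
  right.
  have good B p : F B -> B p -> G `<=` B /\ section_graph B.
    by move=> /FP[->|].
  split=> [p Gp|]; first by exists B0 => //; apply: (good _ _ FB0 Bp0).1.
  split=> [a p q [B FB Bp] [C FC Cq]|p [B FB Bp]|p [B FB Bp]].
  - have [BC|CB] := totF _ _ FB FC.
      by exists C => //; apply: (section_graph_linear (good _ _ FC Cq).2) => //; exact: BC.
    by exists B => //; apply: (section_graph_linear (good _ _ FB Bp).2) => //; exact: CB.
  - exact: (section_graph_functional (good _ _ FB Bp).2).
  - exact: (section_graph_section (good _ _ FB Bp).2).
(* A maximal [A] is not empty, since [G] contains 0 and would be strictly larger. *)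
have {PA} [GA gA] : G `<=` A /\ section_graph A.
  case: PA => [A0|//]; case: (maxA G); last by right; split.
  by rewrite A0; split=> // sub; case: (sub _ G0).
have maxgA B : A `<` B -> ~ section_graph B.
  move=> AB gB; apply: (maxA _ AB); right; split=> //.
  exact: subset_trans GA (properW AB).
have /choice[g Ag] := maximal_section_graph_total gA (GA _ G0) maxgA.
(* The difference of two points of [A] over [u] has first component 0. *)
have uniqA u v : A (u, v) -> g u = v.
  move=> Auv; apply/eqP; rewrite -subr_eq0; apply/eqP.
  have := section_graph_linear gA (-1) Auv (Ag u); rewrite scaleN1r addrC.
  by move=> /(section_graph_functional gA); apply; rewrite /= subrr.
have lin_g : linear g.
  by move=> a u v; apply: uniqA; exact: (section_graph_linear gA a (Ag u) (Ag v)).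
pose lg := GRing.isLinear.Build K U V _ g lin_g.
pose gl : {linear U -> V} := HB.pack g lg.
exists gl => [w|v] /=; first by apply: uniqA; apply: GA; exists w.
by apply: (section_graph_section gA (Ag _)); exists v.
Qed.

End SectionExtension.

Theorem theorem4p2 (K : fieldType) (V : lmodType K) (W : submodClosed V)
    (SW : mulgClosed (lin_end (subspace W)))
    (f : lin_end V) (fL : f \in LSW SW) :
  regular_in (LSW SW) f <->
  regular_in SW (restr (LSW_stable fL)) /\
  range f `&` [set` W] = @subspace_val K V W @` range (restr (LSW_stable fL)).
Proof.
set fW := LSW_stable fL.
have fS : restr fW \in SW.
  by have /asboolP[fW' ] := fL; rewrite (Prop_irrelevance fW fW').
split=> [[_ [g /asboolP[gW gS] fgf]]|[[_ [h hS hfh]] rangeW]].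
  have fgfE v : f (g (f v)) = f v by rewrite -[in RHS]fgf.
  split.
    split=> //; exists (restr gW) => //.
    by apply: lin_endP => w; apply: val_inj; exact: fgfE.
  apply/seteqP; split=> [_ [[v _ <-] /= fvW]|_ [_ [w _ <-] <-]].
    by exists (restr fW (Subspace (gW _ fvW))); [exists (Subspace (gW _ fvW))|exact: fgfE].
  by split; [exists (subspace_val w)|exact: subspace_valP].
have hsec w : range f (subspace_val w) -> f (subspace_val (h w)) = subspace_val w.
  move=> fw; have : (range f `&` [set` W]) (subspace_val w).
    by split=> //; exact: subspace_valP.
  rewrite rangeW => -[_ [w' _ <-] /val_inj <-].
  by rewrite -[in RHS]hfh.
have hlin : linear (fun w => subspace_val (h w)).
  by move=> a u v; rewrite linearP.
pose hl : {linear subspace W -> V} :=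
  HB.pack (fun w => subspace_val (h w)) (GRing.isLinear.Build K _ V _ _ hlin).
have [g gh fgf] := @section_extension K V V f W hl hsec.
split=> //; exists (g : lin_end V); last by apply: lin_endP => v; exact: fgf.
(* On [W] the map [g] agrees with [h], whose values lie in [W]; so [g] restricts to [h], an element
   of [SW]. *)
have gW : stable W (g : lin_end V).
  by move=> w wW; rewrite /= (gh (Subspace wW)) /=; exact: subspace_valP.
apply/asboolP; exists gW; suff -> : restr gW = h by [].
by apply: lin_endP => w; apply: val_inj; exact: gh.
Qed.
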